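(* Let $f_1:S_1\to O$ and $f_2:S_2\to O$ be regular fibrations over a common base $O$, with regular lifting functions $L_{f_1}, L_{f_2}$, having a common fiber space $F_{r_o}=f_1^{-1}(r_o)=f_2^{-1}(r_o)$ over $r_o\in O$. Let $s_o\in F_{r_o}$ and suppose $f_1$ and $f_2$ have conjugate $Lf$-restrictions $f_1^{s_o}$ and $f_2^{g(s_o)}$ by a homeomorphism $g:F_{r_o}\to F_{r_o}$, i.e. $f_1^{s_o}\simeq g'\circ f_2^{g(s_o)}$ where $g'$ is a homotopy inverse of $g$. Suppose $F_{r_o}$ is a pathwise connected ANR. If $S_1$ and $S_2$ are simply connected and $\Omega(O,r_o)$ has the homotopy type of an ANR, then the fibrations $[\Gamma(f_1,s_o)]_g$ and $\Gamma(f_2,g(s_o))$ over $F_{r_o}$ are fiber homotopy equivalent.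
   Context: All spaces are Hausdorff; $I=[0,1]$, $S^I$ is the space of paths in $S$ with the compact-open topology, $\widetilde{s}$ is the constant path at $s$, $\Omega(O,r_o)\subset O^I$ is the space of loops at $r_o$, and $\simeq$ denotes homotopy of maps. ANR means absolute neighborhood retract. ''Fibration'' means Hurewicz fibration. For a fibration $f:S\to O$ let $\bigtriangleup f=\{(s,\alpha)\in S\times O^I: f(s)=\alpha(0)\}$. A lifting function for $f$ is a continuous map $L_f:\bigtriangleup f\to S^I$ with $L_f(s,\alpha)(0)=s$ and $f\circ L_f(s,\alpha)=\alpha$; it is regular if $L_f(s,f\circ\widetilde{s})=\widetilde{s}$ for all $s\in S$. A fibration is regular if it has a regular lifting function. For $F_{r_o}=f^{-1}(r_o)$, the $Lf$-function of $f$ induced by $L_f$ is $\Theta_{L_f}:\Omega(O,r_o)\times F_{r_o}\to F_{r_o}$, $\Theta_{L_f}(\alpha,s)=L_f(s,\alpha)(1)$. For $s\in F_{r_o}$ the $Lf$-restriction is the map $f^{s}:\Omega(O,r_o)\to F_{r_o}$, $f^{s}(\alpha)=\Theta_{L_f}(\alpha,s)$. For a subspace $F\subset S$ and $s\in F$, $\Gamma(S,F,s)=\{\alpha\in S^I:\alpha(0)=s,\ \alpha(1)\in F\}$. For a fibration $f:S\to O$ with fiber $F_{r_o}$ and $s\in F_{r_o}$, $\Gamma(f,s)$ denotes the fibration $\Psi_{s}:\Gamma(S,F_{r_o},s)\to F_{r_o}$, $\Psi_s(\alpha)=\alpha(1)$. For a fibration $p:E\to B$ and a homeomorphism $g$ of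 $B$ onto a space $B'$, $[p]_g$ denotes the fibration $g\circ p:E\to B'$; thus $[\Gamma(f_1,s_o)]_g$ is $g\circ\Psi_{s_o}$. Two fibrations $p_1:E_1\to B$, $p_2:E_2\to B$ are fiber homotopy equivalent if there are maps $u:E_1\to E_2$, $v:E_2\to E_1$ over $\mathrm{id}_B$ such that $v\circ u$ and $u\circ v$ are homotopic to the identities through maps over $\mathrm{id}_B$. *)

(* Defs.v *)
From HB Require Import structures.
From mathcomp Require Import all_boot all_order all_algebra.
From mathcomp Require Import all_classical all_reals all_analysis.

Set Implicit Arguments.
Unset Strict Implicit.
Unset Printing Implicit Defensive.

Import Order.TTheory GRing.Theory Num.Theory.
Import numFieldNormedType.Exports.

Local Open Scope classical_set_scope.
Local Open Scope ring_scope.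

(* Subspaces are the sigma types [set_type A] with the topology induced by the
   inclusion [set_val]; a set is coerced to its [set_type] wherever a type is
   expected. *)

Section Homeomorphisms.

Record homeomorphism (X Y : topologicalType) := Homeomorphism {
  homeo_fun :> X -> Y;
  homeo_inv : Y -> X;
  homeo_continuous : continuous homeo_fun;
  homeo_inv_continuous : continuous homeo_inv;
  homeo_funK : cancel homeo_fun homeo_inv;
  homeo_invK : cancel homeo_inv homeo_fun
}.

Definition homeo_sym (X Y : topologicalType) (g : homeomorphism X Y) :
    homeomorphism Y X :=
  Homeomorphism (@homeo_inv_continuous _ _ g) (@homeo_continuous _ _ g)
    (@homeo_invK _ _ g) (@homeo_funK _ _ g).

(* [p]_g *)
Definition relabel_base (E B B' : topologicalType) (p : E -> B)
    (g : homeomorphism B B') : E -> B' :=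
  g \o p.

End Homeomorphisms.

Section Homotopy.
Variable R : realType.

Definition unit_interval : Type := set_type `[0%R : R, 1%R]%classic.
HB.instance Definition _ :=
  Topological.copy unit_interval (set_type `[0%R : R, 1%R]%classic).
Local Notation I := unit_interval.

Lemma mem_unit_interval0 : (0 : R) \in `[0%R : R, 1%R]%classic.
Proof. by rewrite inE /= in_itv /= lexx ler01. Qed.

Lemma mem_unit_interval1 : (1 : R) \in `[0%R : R, 1%R]%classic.
Proof. by rewrite inE /= in_itv /= lexx ler01. Qed.

Definition I0 : I := exist _ 0 mem_unit_interval0.
Definition I1 : I := exist _ 1 mem_unit_interval1.

(* S^I with the compact-open topology *)
Definition path_space (S : topologicalType) : Type := continuousType I S.
HB.instance Definition _ (S : topologicalType) :=
  Topological.copy (path_space S)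
    (initial_topology (id : continuousType I S -> {compact-open, I -> S})).

Definition path_fun (S : topologicalType) (a : path_space S) : I -> S :=
  (a : continuousType I S).
Coercion path_fun : path_space >-> Funclass.

Definition const_path (S : topologicalType) (s : S) : path_space S :=
  (cst s : continuousType I S).

Definition postcomp_path (S O : topologicalType) (f : continuousType S O)
    (a : path_space S) : path_space O :=
  (f \o (a : continuousType I S) : continuousType I O).

Definition loop_space (O : topologicalType) (r : O) : set (path_space O) :=
  [set a : path_space _ | a I0 = r /\ a I1 = r].

Definition homotopic (X Y : topologicalType) (a b : X -> Y) : Prop :=
  exists H : X * I -> Y,
    [/\ continuous H, forall x, H (x, I0) = a x & forall x, H (x, I1) = b x].

Definition homotopy_inverse (X Y : topologicalType) (g : X -> Y) (g' : Y -> X)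
    : Prop :=
  [/\ continuous g, continuous g', homotopic (g' \o g) id
    & homotopic (g \o g') id].

Definition same_homotopy_type (X Y : topologicalType) : Prop :=
  exists (g : X -> Y) (g' : Y -> X), homotopy_inverse g g'.

Definition path_connected (X : topologicalType) : Prop :=
  forall x y : X, exists a : path_space X, a I0 = x /\ a I1 = y.

Definition simply_connected (X : topologicalType) : Prop :=
  path_connected X /\
  forall (x : X) (a : path_space X), a I0 = x -> a I1 = x ->
    exists H : I * I -> X,
      [/\ continuous H,
          forall t, H (t, I0) = a t,
          forall t, H (t, I1) = x,
          forall u, H (I0, u) = x
        & forall u, H (I1, u) = x].

Definition metrizable (X : topologicalType) : Prop :=
  exists (M : metricType R) (h : homeomorphism X M), True.

Definition neighborhood_retract (M : topologicalType) (A : set M) : Prop :=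
  exists (U : set M) (r : U -> A),
    [/\ open U, A `<=` U, continuous r
      & forall u : U, A (set_val u) -> set_val (r u) = set_val u].

(* ANR for the class of metrizable spaces *)
Definition ANR (X : topologicalType) : Prop :=
  metrizable X /\
  forall (M : metricType R) (A : set M),
    closed A -> homeomorphism X A -> neighborhood_retract A.

End Homotopy.

Arguments loop_space R {O} r _.

Section Fibrations.
Variable R : realType.
Local Notation I := (unit_interval R).
Local Notation I0 := (I0 R).
Local Notation I1 := (I1 R).
Local Notation path_space := (path_space R).
Local Notation const_path := (const_path R).
Local Notation loop_space := (loop_space R).

(* The homotopy lifting property ranges over Hausdorff spaces, every space
   under consideration being Hausdorff. *)
Definition hurewicz_fibration (S O : topologicalType) (f : S -> O) : Prop :=
  continuous f /\
  forall X : topologicalType, hausdorff_space X ->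
  forall (h : X -> S) (H : X * I -> O),
    continuous h -> continuous H -> (forall x, H (x, I0) = f (h x)) ->
    exists G : X * I -> S,
      [/\ continuous G, forall x, G (x, I0) = h x & forall z, f (G z) = H z].

Section Lifting.
Variables (S O : topologicalType) (f : continuousType S O).

Definition lifting_domain : set (S * path_space O) :=
  [set p : S * path_space O | f p.1 = p.2 I0].

Record lifting_function := LiftingFunction {
  lift_path :> lifting_domain -> path_space S;
  lift_continuous : continuous lift_path;
  lift_start : forall p : lifting_domain, lift_path p I0 = (set_val p).1;
  lift_over : forall p : lifting_domain,
    postcomp_path f (lift_path p) = (set_val p).2
}.

Definition lifting_point (s : S) (a : path_space O) (e : f s = a I0) :
    lifting_domain :=
  exist _ (s, a) (mem_set e).

Definition regular_lifting (L : lifting_function) : Prop :=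
  forall s : S,
    L (@lifting_point s (postcomp_path f (const_path s)) erefl) = const_path s.

Definition fiber (r : O) : set S := f @^-1` [set r].

Variables (L : lifting_function) (r : O).

Lemma lifting_at (a : loop_space r) (s : fiber r) :
  f (set_val s) = set_val a I0.
Proof. by rewrite (set_valP s) (set_valP a).1. Qed.

Lemma lift_end_fiber (a : loop_space r) (s : fiber r) :
  fiber r (L (lifting_point (lifting_at a s)) I1).
Proof.
rewrite /fiber /= -[LHS]/(postcomp_path f (L _) I1) lift_over /=.
exact: (set_valP a).2.
Qed.

(* Theta_L *)
Definition Lf_function (p : loop_space r * fiber r) : fiber r :=
  exist (fun x => x \in fiber r) _ (mem_set (lift_end_fiber p.1 p.2)).

Definition Lf_restriction (s : fiber r) (a : loop_space r) : fiber r :=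
  Lf_function (a, s).

End Lifting.

Definition Gamma (S : topologicalType) (A : set S) (s : S) :
    set (path_space S) :=
  [set a : path_space _ | a I0 = s /\ A (a I1)].

(* Psi_s *)
Definition Gamma_end (S : topologicalType) (A : set S) (s : S)
    (a : Gamma A s) : A :=
  exist (fun x => x \in A) (set_val a I1) (mem_set (set_valP a).2).

(* Gamma(f, s) *)
Definition Gamma_fibration (S O : topologicalType) (f : continuousType S O)
    (r : O) (s : fiber f r) : Gamma (fiber f r) (set_val s) -> fiber f r :=
  @Gamma_end S (fiber f r) (set_val s).

(* [a] and [b] are conjugate by [g]: a is homotopic to g' o b for a homotopy
   inverse g' of g. *)
Definition conjugate_by (W F : topologicalType) (g : F -> F) (a b : W -> F)
    : Prop :=
  exists g' : F -> F, homotopy_inverse R g g' /\ homotopic R a (g' \o b).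

Definition fiber_homotopic (E E' B : topologicalType) (p : E -> B)
    (p' : E' -> B) (a b : E -> E') : Prop :=
  exists H : E * I -> E',
    [/\ continuous H, forall x, H (x, I0) = a x, forall x, H (x, I1) = b x
      & forall x t, p' (H (x, t)) = p x].

Definition fiber_homotopy_equivalent (E1 E2 B : topologicalType)
    (p1 : E1 -> B) (p2 : E2 -> B) : Prop :=
  exists (u : E1 -> E2) (v : E2 -> E1),
    [/\ continuous u, continuous v, p2 \o u = p1 & p1 \o v = p2] /\
    (fiber_homotopic p1 p1 (v \o u) id /\ fiber_homotopic p2 p2 (u \o v) id).

End Fibrations.

Arguments Gamma R {S} A s _.
Arguments Gamma_fibration R {S O f r} s _.

(* Main.v *)
Require Import Defs.
From HB Require Import structures.
From mathcomp Require Import all_boot all_order all_algebra.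
From mathcomp Require Import all_classical all_reals all_analysis.
From mathcomp Require Import lra.

Set Implicit Arguments.
Unset Strict Implicit.
Unset Printing Implicit Defensive.

Import Order.TTheory GRing.Theory Num.Theory.
Import numFieldNormedType.Exports.

Local Open Scope classical_set_scope.
Local Open Scope ring_scope.

(** By means of the lifting function, the space of paths [Gamma (f, s)] is
    homotopy equivalent to the loop space of the base: project a path to a loop
    and lift a loop from [s]; under this equivalence the endpoint map becomes
    the Lf-restriction at [s].  Conjugacy of the two Lf-restrictions therefore
    yields a homotopy equivalence [u] between the two path spaces that commutes
    with the endpoint maps up to homotopy.  Endpoint maps have the homotopy
    lifting property, so [u] can be deformed to a map over [F], and a map over
    the base between fibrations which is an ordinary homotopy equivalence is a
    fiber homotopy equivalence (Dold). *)

(** * Continuity of maps into products, subspaces and the reals; gluing along a closed condition *)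

Lemma continuous_pair (X Y Z : topologicalType) (f : X -> Y) (g : X -> Z) :
  continuous f -> continuous g -> continuous (fun x => (f x, g x)).
Proof. by move=> cf cg x; apply: cvg_pair; [exact: cf|exact: cg]. Qed.

Lemma continuous_fun_comp (X Y Z : topologicalType) (f : X -> Y) (g : Y -> Z) :
  continuous g -> continuous f -> continuous (fun x => g (f x)).
Proof. by move=> cg cf x; apply: continuous_comp; [exact: cf|exact: cg]. Qed.

Lemma continuous_fst (X Y Z : topologicalType) (f : X -> Y * Z) :
  continuous f -> continuous (fun x => (f x).1).
Proof.
by move=> cf; apply: continuous_fun_comp cf => -[a b]; exact: cvg_fst.
Qed.

Lemma continuous_snd (X Y Z : topologicalType) (f : X -> Y * Z) :
  continuous f -> continuous (fun x => (f x).2).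
Proof.
by move=> cf; apply: continuous_fun_comp cf => -[a b]; exact: cvg_snd.
Qed.

Lemma continuous_set_val (X Y : topologicalType) (A : set Y) (f : X -> A) :
  continuous f <-> continuous (fun x => set_val (f x)).
Proof.
split=> cf; last exact: continuous_comp_initial.
exact: continuous_fun_comp (@initial_continuous _ _ _) cf.
Qed.

(** Where [a x] and [b x] differ, the sign of [b - a] is constant near [x], so only one branch is
    seen there. Where they agree, both branches have the same value at [x], and points close to [x]
    land in [U] whichever branch applies. *)
Lemma continuous_glue (R : realType) (X Y : topologicalType) (a b : X -> R)
    (f g : X -> Y) : continuous a -> continuous b ->
  continuous f -> continuous g -> (forall x, a x = b x -> f x = g x) ->
  continuous (fun x => if a x <= b x then f x else g x).
Proof.
move=> ca cb cf cg fg x U.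
have cba : b y - a y @[y --> x] --> b x - a x.
  by apply: cvgB; [exact: cb|exact: ca].
case: (ltgtP (a x) (b x)) => [ab|ba|/[dup] ab /fg fgx] Ux;
  rewrite nbhs_simpl /=.
- have := @cvgr_gt _ _ _ (nbhs_filter x) _ _ cba 0.
  rewrite subr_gt0 => /(_ ab); move: (cf _ _ Ux).
  by apply: (filterS2 (nbhs_filter x)) => y /= ? /[!subr_gt0] /ltW ->.
- have := @cvgr_lt _ _ _ (nbhs_filter x) _ _ cba 0.
  rewrite subr_lt0 => /(_ ba); move: (cg _ _ Ux).
  apply: (filterS2 (nbhs_filter x)) => y /= ? /[!subr_lt0].
  by rewrite ltNge => /negbTE ->.
- have Ug : nbhs (g x) U by rewrite -fgx.
  move: (cf _ _ Ux) (cg _ _ Ug); apply: (filterS2 (nbhs_filter x)) => y /=.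
  by case: ifP.
Qed.

Section RealValued.
Variables (R : realType) (X : topologicalType) (f g : X -> R).
Hypotheses (cf : continuous f) (cg : continuous g).

Lemma continuous_addr : continuous (fun x => f x + g x).
Proof. by move=> x; apply: cvgD; [exact: cf|exact: cg]. Qed.

Lemma continuous_subr : continuous (fun x => f x - g x).
Proof. by move=> x; apply: cvgB; [exact: cf|exact: cg]. Qed.

Lemma continuous_minr : continuous (fun x => Num.min (f x) (g x)).
Proof. by move=> x; exact (@continuous_min R X f g x (@cf x) (@cg x)). Qed.

Lemma continuous_maxr : continuous (fun x => Num.max (f x) (g x)).
Proof. by move=> x; exact (@continuous_max R X f g x (@cf x) (@cg x)). Qed.

Lemma continuous_scaler (c : R) : continuous (fun x => c * f x).
Proof. by move=> x; apply: cvgM; [exact: cvg_cst|exact: cf]. Qed.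

End RealValued.

Lemma continuous_const (X Y : topologicalType) (y : Y) :
  continuous (fun _ : X => y).
Proof. by move=> x; exact: cvg_cst. Qed.

Lemma continuous_idfun (X : topologicalType) : continuous (fun x : X => x).
Proof. by move=> x; exact: cvg_id. Qed.

(** * The unit interval as a compact retract of the real line *)

Section UnitInterval.
Variable R : realType.
Local Notation I := (unit_interval R).
Local Notation I0 := (I0 R).
Local Notation I1 := (I1 R).

Lemma clamp_subproof (x : R) :
  Num.max 0 (Num.min 1 x) \in `[0%R : R, 1%R]%classic.
Proof.
rewrite inE /= in_itv /= le_max lexx /= ge_max ler01 /=.
by rewrite ge_min lexx.
Qed.

(** The retraction of the line onto [I]. It lets reparametrizations be written as unrestricted real
    formulas; being constant outside the interval, it also supplies the waiting phases of the
    homotopies below. *)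
Definition clamp (x : R) : I :=
  exist _ (Num.max 0 (Num.min 1 x)) (clamp_subproof x).

Definition ival (t : I) : R := set_val t.

Lemma ival_ge0 (t : I) : 0 <= ival t.
Proof. by have := set_valP t; rewrite /= in_itv /= => /andP[]. Qed.

Lemma ival_le1 (t : I) : ival t <= 1.
Proof. by have := set_valP t; rewrite /= in_itv /= => /andP[]. Qed.

Lemma ival_inj : injective ival.
Proof. by move=> s t /val_inj. Qed.

Lemma ivalE (x : R) : ival (clamp x) = Num.max 0 (Num.min 1 x).
Proof. by []. Qed.

Lemma ivalK (t : I) : clamp (ival t) = t.
Proof.
apply/ival_inj.
by rewrite ivalE (min_idPr (ival_le1 t)) (max_idPr (ival_ge0 t)).
Qed.

Lemma ival0 : ival I0 = 0. Proof. by []. Qed.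
Lemma ival1 : ival I1 = 1. Proof. by []. Qed.

Lemma clamp_le0 (x : R) : x <= 0 -> clamp x = I0.
Proof.
move=> x0; apply/ival_inj; rewrite ivalE ival0; apply/max_idPl.
by rewrite ge_min x0 orbT.
Qed.

Lemma clamp_ge1 (x : R) : 1 <= x -> clamp x = I1.
Proof.
move=> x1; apply/ival_inj.
by rewrite ivalE ival1 (min_idPl x1) (max_idPr ler01).
Qed.

Lemma clampK (x : R) : 0 <= x -> x <= 1 -> ival (clamp x) = x.
Proof. by move=> x0 x1; rewrite ivalE (min_idPr x1) (max_idPr x0). Qed.

Lemma continuous_ival (X : topologicalType) (f : X -> I) :
  continuous f -> continuous (fun x => ival (f x)).
Proof. by move/continuous_set_val. Qed.

Lemma continuous_clamp (X : topologicalType) (f : X -> R) :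
  continuous f -> continuous (fun x => clamp (f x)).
Proof.
move=> cf; apply/continuous_set_val => /=.
apply: continuous_maxr; first exact: continuous_const.
by apply: continuous_minr => //; exact: continuous_const.
Qed.

Lemma unit_interval_compact : compact [set: I].
Proof.
rewrite (_ : setT = clamp @` `[0%R : R, 1%R]%classic).
  apply: continuous_compact; last exact: segment_compact.
  by apply: continuous_subspaceT; apply: continuous_clamp => x; exact: cvg_id.
apply/esym; rewrite -subTset => t _; exists (ival t); last exact: ivalK.
exact: set_valP.
Qed.

Lemma unit_interval_locally_compact : locally_compact [set: I].
Proof.
move=> t _; exists setT; first by rewrite withinET; exact: filterT.
by split; [exact: unit_interval_compact|exact: closedT].
Qed.

Lemma unit_interval_regular : regular_space I.
Proof. exact: (@uniform_regular (set_type `[0%R : R, 1%R]%classic)). Qed.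

End UnitInterval.

(** * Evaluation and currying for the compact-open topology *)

Section PathSpace.
Variable R : realType.
Local Notation I := (unit_interval R).
Local Notation path_space := (path_space R).
Variable S : topologicalType.

Definition path_of (f : I -> S) (cf : continuous f) : path_space S :=
  (mkcts cf : continuousType I S).

Lemma path_ext (a b : path_space S) : path_fun a =1 path_fun b -> a = b.
Proof. by move=> ab; apply/continuousEP. Qed.

Lemma continuous_path (a : path_space S) : continuous (path_fun a).
Proof. exact: (@cts_fun _ _ (a : continuousType I S)). Qed.

(** Joint continuity of evaluation rests on [I] being locally compact and regular. *)
Lemma continuous_eval_path (X : topologicalType) (f : X -> path_space S)
    (h : X -> I) : continuous f -> continuous h ->
  continuous (fun x => path_fun (f x) (h x)).
Proof.
move=> cf ch.
have ce : continuous (uncurry (@path_fun R S)).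
  apply: continuous_uncurry_regular.
  - exact: unit_interval_locally_compact.
  - exact: unit_interval_regular.
  - exact: initial_continuous.
  - exact: continuous_path.
exact: continuous_fun_comp ce (continuous_pair cf ch).
Qed.

Lemma continuous_into_path (X : topologicalType) (f : X -> path_space S) :
  continuous (fun p : X * I => path_fun (f p.1) p.2) -> continuous f.
Proof.
move=> cf; apply: continuous_comp_initial.
exact: (continuous_curry_fun cf).
Qed.

End PathSpace.

(** * The calculus of homotopies and of homotopies over a base *)

Section Homotopies.
Variable R : realType.
Local Notation I := (unit_interval R).
Local Notation I0 := (I0 R).
Local Notation I1 := (I1 R).

Definition concat_homotopy (X Y : topologicalType) (H1 H2 : X * I -> Y)
    (z : X * I) : Y :=
  if ival z.2 <= 2^-1 then H1 (z.1, clamp (2 * ival z.2))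
  else H2 (z.1, clamp (2 * ival z.2 - 1)).

Lemma concat_homotopy_continuous (X Y : topologicalType) (H1 H2 : X * I -> Y) :
  continuous H1 -> continuous H2 -> (forall x, H1 (x, I1) = H2 (x, I0)) ->
  continuous (concat_homotopy H1 H2).
Proof.
move=> c1 c2 H12.
have cfst : continuous (fun z : X * I => z.1).
  exact: (continuous_fst (@continuous_idfun _)).
have cval : continuous (fun z : X * I => ival z.2).
  exact: (continuous_ival (continuous_snd (@continuous_idfun _))).
have c2val : continuous (fun z : X * I => 2 * ival z.2).
  exact: continuous_scaler.
apply: continuous_glue => //.
- exact: continuous_const.
- exact: (continuous_fun_comp c1 (continuous_pair cfst (continuous_clamp c2val))).
- apply: (continuous_fun_comp c2 (continuous_pair cfst (continuous_clamp _))).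
  exact: (continuous_subr c2val (@continuous_const _ _ (1 : R))).
move=> -[x t] /= ->; rewrite mulfV ?pnatr_eq0// subrr.
by rewrite clamp_ge1// clamp_le0.
Qed.

Lemma concat_homotopy0 (X Y : topologicalType) (H1 H2 : X * I -> Y) (x : X) :
  concat_homotopy H1 H2 (x, I0) = H1 (x, I0).
Proof. by rewrite /concat_homotopy ival0 /= invr_ge0 ler0n mulr0 clamp_le0. Qed.

Lemma concat_homotopy1 (X Y : topologicalType) (H1 H2 : X * I -> Y) (x : X) :
  concat_homotopy H1 H2 (x, I1) = H2 (x, I1).
Proof.
rewrite /concat_homotopy ival1 /= ifF; last by apply/negbTE; lra.
by rewrite clamp_ge1//; lra.
Qed.

Section FiberHomotopy.
Variables (E E' B : topologicalType) (p : E -> B) (p' : E' -> B).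

Lemma fiber_homotopic_sym (a b : E -> E') :
  fiber_homotopic R p p' a b -> fiber_homotopic R p p' b a.
Proof.
move=> [H [cH H0 H1 pH]]; exists (fun z => H (z.1, clamp (1 - ival z.2))).
split=> [|x|x|x t] /=.
- apply: (continuous_fun_comp cH); apply: continuous_pair.
    exact: (continuous_fst (@continuous_idfun _)).
  apply: continuous_clamp; apply: continuous_subr; first exact: continuous_const.
  exact: (continuous_ival (continuous_snd (@continuous_idfun _))).
- by rewrite ival0 subr0 clamp_ge1.
- by rewrite ival1 subrr clamp_le0.
- exact: pH.
Qed.

Lemma fiber_homotopic_trans (b a c : E -> E') : fiber_homotopic R p p' a b ->
  fiber_homotopic R p p' b c -> fiber_homotopic R p p' a c.
Proof.
move=> [H [cH H0 H1 pH]] [K [cK K0 K1 pK]]; exists (concat_homotopy H K).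
split=> [|x|x|x t].
- by apply: concat_homotopy_continuous => // x; rewrite H1 K0.
- by rewrite concat_homotopy0.
- by rewrite concat_homotopy1.
- by rewrite /concat_homotopy; case: ifP.
Qed.

Lemma fiber_homotopic_postcomp (E'' : topologicalType) (p'' : E'' -> B)
    (c : E' -> E'') (a b : E -> E') : continuous c ->
  (forall y, p'' (c y) = p' y) -> fiber_homotopic R p p' a b ->
  fiber_homotopic R p p'' (c \o a) (c \o b).
Proof.
move=> cc pc [H [cH H0 H1 pH]]; exists (c \o H); split=> [|x|x|x t] /=.
- exact: continuous_fun_comp cc cH.
- by rewrite H0.
- by rewrite H1.
- by rewrite pc pH.
Qed.

Lemma fiber_homotopic_precomp (D : topologicalType) (q : D -> B)
    (d : D -> E) (a b : E -> E') : continuous d ->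
  (forall y, p (d y) = q y) -> fiber_homotopic R p p' a b ->
  fiber_homotopic R q p' (a \o d) (b \o d).
Proof.
move=> cd pd [H [cH H0 H1 pH]]; exists (fun z => H (d z.1, z.2)).
split=> [|x|x|x t] /=; rewrite ?H0 ?H1 ?pH//.
apply: (continuous_fun_comp cH); apply: continuous_pair.
  exact: (continuous_fun_comp cd (continuous_fst (@continuous_idfun _))).
exact: (continuous_snd (@continuous_idfun _)).
Qed.

End FiberHomotopy.

(** Over constant projections the condition of being vertical is void, so the rules proved for
    homotopies over a base specialize to ordinary ones. *)
Lemma homotopicP (X Y : topologicalType) (a b : X -> Y) :
  homotopic R a b <-> fiber_homotopic R (fun=> I0) (fun=> I0) a b.
Proof. by split=> [[H [? ? ?]]|[H [? ? ? ?]]]; exists H. Qed.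

Section Homotopic.
Variables X Y : topologicalType.

Lemma homotopic_sym (a b : X -> Y) : homotopic R a b -> homotopic R b a.
Proof. by move=> /homotopicP/fiber_homotopic_sym/homotopicP. Qed.

Lemma homotopic_trans (b a c : X -> Y) :
  homotopic R a b -> homotopic R b c -> homotopic R a c.
Proof.
move=> /homotopicP ab /homotopicP bc; apply/homotopicP.
exact: fiber_homotopic_trans ab bc.
Qed.

Lemma homotopic_postcomp (Z : topologicalType) (c : Y -> Z) (a b : X -> Y) :
  continuous c -> homotopic R a b -> homotopic R (c \o a) (c \o b).
Proof.
move=> cc /homotopicP ab; apply/homotopicP.
exact: (fiber_homotopic_postcomp cc _ ab).
Qed.

Lemma homotopic_precomp (W : topologicalType) (d : W -> X) (a b : X -> Y) :
  continuous d -> homotopic R a b -> homotopic R (a \o d) (b \o d).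
Proof.
move=> cd /homotopicP ab; apply/homotopicP.
exact: (fiber_homotopic_precomp cd _ ab).
Qed.

End Homotopic.

Lemma fiber_homotopic_homotopic (E E' B : topologicalType) (p : E -> B)
    (p' : E' -> B) (a b : E -> E') :
  fiber_homotopic R p p' a b -> homotopic R a b.
Proof. by move=> [H [? ? ? ?]]; exists H. Qed.

(** Test spaces are arbitrary here, so that [E] and [E * I] themselves can serve as test spaces
    without any separation argument. *)
Definition homotopy_lifting (E B : topologicalType) (p : E -> B) : Prop :=
  forall (X : topologicalType) (h : X -> E) (H : X * I -> B),
    continuous h -> continuous H -> (forall x, H (x, I0) = p (h x)) ->
    exists G : X * I -> E,
      [/\ continuous G, forall x, G (x, I0) = h x & forall z, p (G z) = H z].

(** * Deforming maps to maps over the base, and Dold's theorem *)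

Lemma lift_up_to_homotopy (X E B : topologicalType) (p : E -> B) (a : X -> E)
    (c : X -> B) : homotopy_lifting p -> continuous a ->
  homotopic R (p \o a) c ->
  exists a', [/\ continuous a', forall x, p (a' x) = c x & homotopic R a a'].
Proof.
move=> hlp ca [H [cH H0 H1]]; have [G [cG G0 pG]] := hlp _ _ _ ca cH H0.
exists (fun x => G (x, I1)); split=> [|x|].
- apply: (continuous_fun_comp cG); apply: continuous_pair.
    exact: continuous_idfun.
  exact: continuous_const.
- by rewrite pG H1.
- by exists G.
Qed.

(** The core of Dold's theorem. The homotopy [h] from [phi] to the identity need not be vertical;
    lifting its projection from the identity gives [k], and [psi] is the end of [k]. Running
    [phi \o k] backwards and then [h] joins [phi \o psi] to the identity, and its projection
    retraces its own steps. Lifting the contraction of that projection makes the homotopy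
    vertical. *)
Lemma fiber_right_inverse (E B : topologicalType) (p : E -> B) (phi : E -> E) :
  continuous p -> homotopy_lifting p ->
  continuous phi -> (forall x, p (phi x) = p x) -> homotopic R phi id ->
  exists psi, [/\ continuous psi, forall x, p (psi x) = p x
    & fiber_homotopic R p p (phi \o psi) id].
Proof.
move=> cp hlp cphi pphi [h [ch h0 h1]].
have [k [ck k0 pk]] : exists k : E * I -> E, [/\ continuous k,
    forall x, k (x, I0) = x & forall z, p (k z) = p (h z)].
  apply: (hlp _ id (p \o h)); first exact: continuous_idfun.
  - exact: continuous_fun_comp cp ch.
  - by move=> x /=; rewrite h0 pphi.
pose psi x := k (x, I1).
have cpsi : continuous psi.
  apply: (continuous_fun_comp ck); apply: continuous_pair.
    exact: continuous_idfun.
  exact: continuous_const.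
have ppsi x : p (psi x) = p x by rewrite /psi pk h1.
exists psi; split=> //.
pose J := concat_homotopy (fun z => phi (k (z.1, clamp (1 - ival z.2)))) h.
have cJ : continuous J.
  apply: concat_homotopy_continuous => //.
    apply: (continuous_fun_comp cphi); apply: (continuous_fun_comp ck).
    apply: continuous_pair; first exact: (continuous_fst (@continuous_idfun _)).
    apply: continuous_clamp; apply: continuous_subr.
      exact: continuous_const.
    exact: (continuous_ival (continuous_snd (@continuous_idfun _))).
  by move=> x; rewrite /= ival1 subrr clamp_le0// k0 h0.
(* The loop [p \o J] runs along a path and back, hence it contracts. *)
pose K (z : E * I * I) :=
  p (h (z.1.1, clamp (Num.max `|1 - 2 * ival z.1.2| (ival z.2)))).
have cK : continuous K.
  apply: (continuous_fun_comp cp); apply: (continuous_fun_comp ch).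
  have c1 : continuous (fun z : E * I * I => z.1).
    exact: (continuous_fst (@continuous_idfun _)).
  apply: continuous_pair; first exact: continuous_fst c1.
  apply: continuous_clamp; apply: continuous_maxr; last first.
    exact: (continuous_ival (continuous_snd (@continuous_idfun _))).
  apply: (continuous_fun_comp (@norm_continuous _ R)).
  apply: continuous_subr; first exact: continuous_const.
  by apply: continuous_scaler; apply: continuous_ival; exact: continuous_snd c1.
have KJ z : K (z, I0) = p (J z).
  case: z => x t; rewrite /K /J /concat_homotopy /= ival0.
  have [t0 t1] := (ival_ge0 t, ival_le1 t); case: ifPn => ht.
    rewrite pphi pk; congr (p (h (_, _))).
    rewrite ger0_norm; last by lra.
    rewrite (max_idPl _); last by lra.
    by rewrite clampK //; lra.
  rewrite ler0_norm; last by lra.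
  by rewrite (max_idPl _) ?opprB//; lra.
(* On these three sides the maximum in [K] equals 1, so [h] has reached the identity. *)
have K1 x s t : [|| s == I0, s == I1 | t == I1] -> K (x, s, t) = p x.
  move=> st; rewrite /K /= clamp_ge1 ?h1//; case/or3P: st => /eqP->.
  - by rewrite ival0 le_max mulr0 subr0 normr1 lexx.
  - by rewrite ival1 le_max mulr1 distrC; apply/orP; left; rewrite ger0_norm; lra.
  - by rewrite ival1 le_max lexx orbT.
have [G [cG G0 pG]] := hlp _ _ _ cJ cK KJ.
(* Go around the three sides of the square over which [K] is vertical. *)
exists (fun z => G (z.1, clamp (3 * ival z.2 - 1),
                    clamp (Num.min (3 * ival z.2) (3 - 3 * ival z.2)))).
split=> [|x|x|x t] /=.
- have c1 : continuous (fun z : E * I => z.1).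
    exact: (continuous_fst (@continuous_idfun _)).
  have c3 : continuous (fun z : E * I => 3 * ival z.2).
    apply: continuous_scaler.
    exact: (continuous_ival (continuous_snd (@continuous_idfun _))).
  apply: (continuous_fun_comp cG); apply: continuous_pair.
    apply: (continuous_pair c1); apply: continuous_clamp.
    by apply: continuous_subr => //; exact: continuous_const.
  apply: continuous_clamp; apply: continuous_minr => //.
  by apply: continuous_subr => //; exact: continuous_const.
- rewrite ival0 mulr0 clamp_le0; last by lra.
  rewrite clamp_le0; last by rewrite ge_min lexx.
  by rewrite G0 /J concat_homotopy0 /= ival0 subr0 clamp_ge1.
- rewrite ival1 clamp_ge1; last by lra.
  rewrite clamp_le0; last by rewrite ge_min; apply/orP; right; lra.
  by rewrite G0 /J concat_homotopy1.
- rewrite pG K1//.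
  (* The three thirds of the time interval: first coordinate at [I0], then (last third) at [I1], and
     in the middle third second coordinate at [I1]. *)
  have [t1|t1] := lerP (3 * ival t) 1; first by rewrite clamp_le0 ?eqxx//; lra.
  have [t2|t2] := lerP 2 (3 * ival t).
    by rewrite clamp_ge1 ?eqxx ?orbT//; lra.
  by rewrite [X in _ || (_ || (X == _))]clamp_ge1 ?eqxx ?orbT// le_min; lra.
Qed.

(** A right inverse [w] of [u] over [B] is again a homotopy equivalence, so it has a right inverse
    [u'] over [B] in turn. As in a group, [u] and [u'] then agree up to vertical homotopy, and [w]
    is a two-sided inverse of [u]. *)
Lemma dold_fiber_homotopy_equivalence (E1 E2 B : topologicalType)
    (p1 : E1 -> B) (p2 : E2 -> B) (u : E1 -> E2) (v : E2 -> E1) :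
  continuous p1 -> continuous p2 ->
  homotopy_lifting p1 -> homotopy_lifting p2 ->
  (forall x, p2 (u x) = p1 x) -> homotopy_inverse R u v ->
  fiber_homotopy_equivalent R p1 p2.
Proof.
move=> cp1 cp2 hlp1 hlp2 pu hinv.
(* The inverse [b] lies over [B] only up to homotopy. It is first deformed to [b'] over [B]; then
   [a \o b'] lies over [B] and is homotopic to the identity, and composing [b'] with the [psi] of
   the previous lemma corrects it. *)
have right_inverse (D1 D2 : topologicalType) (q1 : D1 -> B) (q2 : D2 -> B)
    (a : D1 -> D2) (b : D2 -> D1) : continuous q2 -> homotopy_lifting q1 ->
    homotopy_lifting q2 -> (forall x, q2 (a x) = q1 x) ->
    homotopy_inverse R a b -> exists w, [/\ continuous w,
      forall y, q1 (w y) = q2 y & fiber_homotopic R q2 q2 (a \o w) id].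
  move=> cq2 hq1 hq2 qa [ca cb ba ab].
  have qb : homotopic R (q1 \o b) q2.
    have -> : q1 \o b = q2 \o (a \o b) by apply/funext => y /=; rewrite qa.
    exact: homotopic_postcomp cq2 ab.
  have [b' [cb' qb' bb']] := lift_up_to_homotopy hq1 cb qb.
  have [] := @fiber_right_inverse _ _ q2 (a \o b') cq2 hq2.
  - exact: continuous_fun_comp ca cb'.
  - by move=> y /=; rewrite qa qb'.
  - apply: homotopic_trans ab; apply: homotopic_postcomp => //.
    exact: homotopic_sym.
  move=> psi [cpsi qpsi fh]; exists (b' \o psi); split=> //.
    exact: continuous_fun_comp cb' cpsi.
  by move=> y /=; rewrite qb' qpsi.
have [w [cw pw uw]] := right_inverse _ _ _ _ _ _ cp2 hlp1 hlp2 pu hinv.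
have [cu cv vu uv] := hinv.
(* Chain: [w u ~ v u w u ~ v u ~ id]. *)
have wu : homotopic R (w \o u) id.
  apply: homotopic_trans (vu); apply: homotopic_sym.
  apply: (@homotopic_trans _ _ (v \o u \o (w \o u))).
    have := homotopic_precomp cu (fiber_homotopic_homotopic uw).
    by move=> /(homotopic_postcomp cv)/homotopic_sym.
  exact: homotopic_precomp (continuous_fun_comp cw cu) vu.
have winv : homotopy_inverse R w u.
  by split=> //; exact: fiber_homotopic_homotopic uw.
have [u' [cu' pu' wu']] := right_inverse _ _ _ _ _ _ cp1 hlp2 hlp1 pw winv.
exists u, w; split; first by split=> //; apply/funext => x /=.
split=> //.
(* Vertically, [u ~ u w u' ~ u']. *)
have uu' : fiber_homotopic R p1 p2 u u'.
  apply: (@fiber_homotopic_trans _ _ _ _ _ (u \o w \o u')).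
    apply: fiber_homotopic_sym.
    exact: (fiber_homotopic_postcomp cu pu wu').
  exact: (fiber_homotopic_precomp cu' pu' uw).
by apply: fiber_homotopic_trans wu'; exact: fiber_homotopic_postcomp uu'.
Qed.

End Homotopies.

(** * Families of paths given by formulas, and the endpoint fibration *)

Lemma subtype_corestriction (X Y : topologicalType) (A : set Y) (f : X -> Y) :
  continuous f -> (forall x, A (f x)) ->
  exists f' : X -> A, continuous f' /\ forall x, set_val (f' x) = f x.
Proof.
move=> cf Af; exists (fun x => exist _ (f x) (mem_set (Af x))).
by split=> //; apply/continuous_set_val.
Qed.

Section Paths.
Variable R : realType.
Local Notation I := (unit_interval R).
Local Notation I0 := (I0 R).
Local Notation I1 := (I1 R).
Local Notation path_space := (path_space R).

Lemma path_adjoint (X S : topologicalType) (f : X * I -> S) : continuous f ->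
  exists f' : X -> path_space S,
    continuous f' /\ forall x t, path_fun (f' x) t = f (x, t).
Proof.
move=> cf.
have cfx x : continuous (fun t => f (x, t)).
  apply: (continuous_fun_comp cf).
  by apply: continuous_pair; [exact: continuous_const|exact: continuous_idfun].
exists (fun x => path_of (cfx x)); split=> //.
apply: continuous_into_path; rewrite (_ : (fun _ => _) = f)//.
by apply/funext => -[].
Qed.

Lemma homotopy_lifting_relabel (E B B' : topologicalType) (p : E -> B)
    (g : homeomorphism B B') :
  homotopy_lifting R p -> homotopy_lifting R (relabel_base p g).
Proof.
move=> hlp X h H ch cH H0.
have [||G [cG G0 pG]] := hlp X h (homeo_inv g \o H) ch.
- exact: continuous_fun_comp (@homeo_inv_continuous _ _ g) cH.
- by move=> x /=; rewrite H0 homeo_funK.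
by exists G; split=> // z; rewrite /relabel_base /= pG /= homeo_invK.
Qed.

Lemma continuous_relabel (E B B' : topologicalType) (p : E -> B)
    (g : homeomorphism B B') : continuous p -> continuous (relabel_base p g).
Proof. exact: continuous_fun_comp (@homeo_continuous _ _ g). Qed.

Section GammaEnd.
Variables (S : topologicalType) (A : set S) (s : S).

Lemma continuous_Gamma_end : continuous (@Gamma_end R S A s).
Proof.
apply/continuous_set_val => /=; apply: continuous_eval_path.
  by apply/continuous_set_val; exact: continuous_idfun.
exact: continuous_const.
Qed.

(* The endpoint of a path is dragged along a homotopy by appending the track
   of the homotopy to the path. *)
Lemma homotopy_lifting_Gamma_end : homotopy_lifting R (@Gamma_end R S A s).
Proof.
move=> X h H ch cH H0.
(* At homotopy time [t] the path followed by its track has length [1 + t]. The value of [r] is the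
   position along it: up to 1 on the original path, beyond 1 on the track. *)
pose r (z : X * I * I) : R := (1 + ival z.1.2) * ival z.2.
have c1 : continuous (fun z : X * I * I => z.1).
  exact: (continuous_fst (@continuous_idfun _)).
have c11 : continuous (fun z : X * I * I => z.1.1) by exact: continuous_fst.
have cr : continuous r.
  move=> z; apply: cvgM.
    apply: cvgD; first exact: cvg_cst.
    exact: (continuous_ival (continuous_snd c1)).
  exact: (continuous_ival (continuous_snd (@continuous_idfun _))).
pose Phi z := if r z <= 1 then path_fun (set_val (h z.1.1)) (clamp (r z))
              else set_val (H (z.1.1, clamp (r z - 1))).
have cPhi : continuous Phi.
  apply: continuous_glue => //; first exact: continuous_const.
  - apply: continuous_eval_path; last exact: continuous_clamp.
    by apply/continuous_set_val; exact: continuous_fun_comp ch c11.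
  - apply/continuous_set_val; apply: (continuous_fun_comp cH).
    apply: (continuous_pair c11); apply: continuous_clamp.
    by apply: continuous_subr => //; exact: continuous_const.
  - by move=> z ->; rewrite subrr clamp_ge1// clamp_le0// H0.
have [G [cG GE]] := path_adjoint cPhi.
have GA z : Gamma R A s (G z).
  split; rewrite GE /Phi /r /=.
    by rewrite ival0 mulr0 ler01 clamp_le0// (set_valP (h z.1)).1.
  rewrite ival1 mulr1; case: ifPn => [t0|_]; last exact: set_valP.
  rewrite clamp_ge1; last by rewrite lerDl ival_ge0.
  exact: (set_valP (h z.1)).2.
have [G' [cG' G'E]] := subtype_corestriction cG GA.
exists G'; split=> // [x|[x t]]; apply/val_inj.
  rewrite [LHS]G'E; apply: path_ext => t; rewrite GE /Phi /r /=.
  by rewrite ival0 addr0 mul1r ival_le1 ivalK.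
(* The final position is [1 + t]; it stays on the original path only for [t = 0], where both
   branches agree. *)
rewrite /= G'E GE /Phi /r /= ival1 mulr1; case: ifPn => [t0|_].
  have -> : t = I0.
    by apply/ival_inj; rewrite ival0; have := ival_ge0 t; lra.
  by rewrite H0 ival0 addr0 clamp_ge1.
by rewrite addrAC subrr add0r ivalK.
Qed.

End GammaEnd.

(** * Comparison of the paths from [s] into the fiber with the loops of the base *)

Section LoopSpace.
Variables (S O : topologicalType) (f : continuousType S O).
Variables (L : lifting_function R f) (r : O) (s : fiber f r).

Lemma lift_fiberP (p : lifting_domain f) (t : I) :
  f (path_fun (L p) t) = path_fun (set_val p).2 t.
Proof. by rewrite -(lift_over L p). Qed.

(** Projecting a lift returns the loop exactly. Conversely, a path [a] is joined to the lift of its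
    projection by following [a] up to time [t] and then lifting the rest of [f \o a] from the point
    reached; [t = 0] gives the lift, [t = 1] gives [a]. *)
Lemma Gamma_loop_space_equivalence :
  exists (pi : Gamma R (fiber f r) (set_val s) -> loop_space R r)
         (lambda : loop_space R r -> Gamma R (fiber f r) (set_val s)),
    [/\ continuous pi, continuous lambda, forall a, pi (lambda a) = a,
        homotopic R (lambda \o pi) id
      & forall a, Gamma_fibration R s (lambda a) = Lf_restriction L s a].
Proof.
have piP (a : Gamma R (fiber f r) (set_val s)) :
    loop_space R r (postcomp_path f (set_val a)).
  have [a0 a1] := set_valP a.
  by split; rewrite /postcomp_path /path_fun /=; [rewrite [_ I0]a0|];
     [exact: (set_valP s)|exact: a1].
have lambdaP (a : loop_space R r) :
    Gamma R (fiber f r) (set_val s) (L (lifting_point (lifting_at a s))).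
  by split; [rewrite lift_start|exact: lift_end_fiber].
have cval (T : topologicalType) (B : set T) : continuous (@set_val T B).
  by apply/continuous_set_val; exact: continuous_idfun.
(* The part of [a] after a given time, shifted to start at 0; the clamp makes it rest at the
   endpoint of [a]. Its projection is the path [tail] to be lifted. *)
have cdrag : continuous (fun z : Gamma R (fiber f r) (set_val s) * I * I =>
    path_fun (set_val z.1.1) (clamp (ival z.1.2 + ival z.2))).
  apply: continuous_eval_path.
    exact: (continuous_fun_comp (cval _ _) (continuous_fst
      (continuous_fst (@continuous_idfun _)))).
  apply: continuous_clamp; apply: continuous_addr; apply: continuous_ival.
    exact: (continuous_snd (continuous_fst (@continuous_idfun _))).
  exact: (continuous_snd (@continuous_idfun _)).
have cpost : continuous f by exact: cts_fun.
have [tail [ctail tailE]] := path_adjoint (continuous_fun_comp cpost cdrag).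
pose head_tail (z : Gamma R (fiber f r) (set_val s) * I) :=
  (path_fun (set_val z.1) z.2, tail z).
have cht : continuous head_tail.
  apply: continuous_pair ctail; apply: continuous_eval_path.
    apply: (continuous_fun_comp (cval _ _)).
    exact: (continuous_fst (@continuous_idfun _)).
  exact: (continuous_snd (@continuous_idfun _)).
have htP z : lifting_domain f (head_tail z).
  by case: z => a m; rewrite /lifting_domain /= tailE /= addr0 ivalK.
have [D [cD DE]] := subtype_corestriction cht htP.
(* With [m] the minimum of the homotopy time [t] and the path parameter [x], one formula covers both
   phases: for [x <= t] the lift from [a x] is read at time 0 and gives [a x]; for [x >= t] the lift
   from [a t] is read at time [x - t]. *)
pose m (z : Gamma R (fiber f r) (set_val s) * I * I) :=
  clamp (Num.min (ival z.1.2) (ival z.2)).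
have c1 : continuous (fun z : Gamma R (fiber f r) (set_val s) * I * I => z.1).
  exact: (continuous_fst (@continuous_idfun _)).
have cv2 : continuous
    (fun z : Gamma R (fiber f r) (set_val s) * I * I => ival z.2).
  exact: (continuous_ival (continuous_snd (@continuous_idfun _))).
have cm : continuous m.
  apply: continuous_clamp; apply: continuous_minr => //.
  exact: (continuous_ival (continuous_snd c1)).
pose Phi z := path_fun (L (D (z.1.1, m z))) (clamp (ival z.2 - ival (m z))).
have cPhi : continuous Phi.
  apply: continuous_eval_path.
    apply: (continuous_fun_comp (@lift_continuous _ _ _ _ L)).
    exact: (continuous_fun_comp cD (continuous_pair (continuous_fst c1) cm)).
  by apply: continuous_clamp; apply: continuous_subr => //; exact: continuous_ival.
have [G [cG GE]] := path_adjoint cPhi.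
have GP z : Gamma R (fiber f r) (set_val s) (G z).
  case: z => a t; have [a0 a1] := set_valP a; split; rewrite GE /Phi /m /=.
    rewrite ival0 clamp_le0 ?ge_min ?lexx ?orbT// ival0 subrr clamp_le0//.
    by rewrite lift_start DE.
  (* At parameter 1 the lift from [a t] is read at [1 - t], over the point [f (a I1)], so the
     endpoint stays in the fiber. *)
  rewrite ival1 (min_idPl (ival_le1 t)) ivalK /fiber /preimage /=.
  rewrite lift_fiberP DE /= tailE /=.
  have t1 := ival_le1 t; have t0 := ival_ge0 t.
  rewrite clampK; [|lra|lra]; rewrite addrC subrK clamp_ge1//.
have [H [cH HE]] := subtype_corestriction cG GP.
pose pi a : loop_space R r :=
  exist (fun x => x \in loop_space R r) _ (mem_set (piP a)).
pose lambda a : Gamma R (fiber f r) (set_val s) :=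
  exist (fun x => x \in Gamma R (fiber f r) (set_val s)) _ (mem_set (lambdaP a)).
exists pi, lambda; split.
- apply/continuous_set_val; apply: continuous_into_path.
  apply: (continuous_fun_comp cpost); apply: continuous_eval_path.
    apply: (continuous_fun_comp (cval _ _)).
    exact: (continuous_fst (@continuous_idfun _)).
  exact: (continuous_snd (@continuous_idfun _)).
- apply/continuous_set_val; apply: (continuous_fun_comp (@lift_continuous _ _ _ _ L)).
  apply/continuous_set_val; apply: continuous_pair (cval _ _).
  exact: continuous_const.
- by move=> a; apply/val_inj; rewrite /= lift_over.
- exists H; split=> // a; apply/val_inj; rewrite [LHS]HE; apply: path_ext => t;
    rewrite GE /Phi /m /=.
    rewrite ival0 (min_idPl (ival_ge0 t)) clamp_le0// ival0 subr0 ivalK.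
    congr (path_fun (L _) _); apply/val_inj; rewrite [LHS]DE /head_tail /=.
    congr pair; first exact: (set_valP a).1.
    by apply: path_ext => x; rewrite tailE /= add0r ivalK.
  rewrite ival1 (min_idPr (ival_le1 t)) ivalK subrr clamp_le0//.
  by rewrite lift_start DE.
- by move=> a; exact: val_inj.
Qed.

End LoopSpace.
End Paths.

(** * Fiber homotopy equivalence of the two endpoint fibrations *)

Theorem theorem4p4 (R : realType) (S1 S2 O F : topologicalType)
    (hausS1 : hausdorff_space S1) (hausS2 : hausdorff_space S2)
    (hausO : hausdorff_space O)
    (f1 : continuousType S1 O) (f2 : continuousType S2 O)
    (fib1 : hurewicz_fibration R f1) (fib2 : hurewicz_fibration R f2)
    (L1 : lifting_function R f1) (L2 : lifting_function R f2)
    (reg1 : regular_lifting L1) (reg2 : regular_lifting L2)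
    (r0 : O)
    (i1 : homeomorphism F (fiber f1 r0)) (i2 : homeomorphism F (fiber f2 r0))
    (s0 : F) (g : homeomorphism F F)
    (conjL : conjugate_by R g
      (homeo_sym i1 \o Lf_restriction L1 (i1 s0))
      (homeo_sym i2 \o Lf_restriction L2 (i2 (g s0))))
    (pcF : path_connected R F) (anrF : ANR R F)
    (scS1 : simply_connected R S1) (scS2 : simply_connected R S2)
    (anrO : exists A : topologicalType,
      ANR R A /\ same_homotopy_type R (loop_space R r0) A) :
  fiber_homotopy_equivalent R
    (relabel_base (relabel_base (Gamma_fibration R (i1 s0)) (homeo_sym i1)) g)
    (relabel_base (Gamma_fibration R (i2 (g s0))) (homeo_sym i2)).
Proof.
set p1 := relabel_base (relabel_base _ _) g; set p2 := relabel_base _ _.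
have cp1 : continuous p1.
  by do 2 apply: continuous_relabel; exact: continuous_Gamma_end.
have cp2 : continuous p2.
  by apply: continuous_relabel; exact: continuous_Gamma_end.
have hlp1 : homotopy_lifting R p1.
  by do 2 apply: homotopy_lifting_relabel; exact: homotopy_lifting_Gamma_end.
have hlp2 : homotopy_lifting R p2.
  by apply: homotopy_lifting_relabel; exact: homotopy_lifting_Gamma_end.
have [pi1 [l1 [cpi1 cl1 pl1 lp1 end1]]] := Gamma_loop_space_equivalence L1 (i1 s0).
have [pi2 [l2 [cpi2 cl2 pl2 lp2 end2]]] :=
  Gamma_loop_space_equivalence L2 (i2 (g s0)).
have [g' [[cg cg' g'g gg'] Lg]] := conjL.
(* Both comparison maps pass through the common loop space. Since [pi1 \o l1] and [pi2 \o l2] are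
   identities, the inner factors of the composites cancel. *)
have cu : continuous (l2 \o pi1) by exact: continuous_fun_comp cl2 cpi1.
have cv : continuous (l1 \o pi2) by exact: continuous_fun_comp cl1 cpi2.
have vu : homotopic R ((l1 \o pi2) \o (l2 \o pi1)) id.
  by rewrite (_ : _ \o _ = l1 \o pi1)//; apply/funext => a /=; rewrite pl2.
have uv : homotopic R ((l2 \o pi1) \o (l1 \o pi2)) id.
  by rewrite (_ : _ \o _ = l2 \o pi2)//; apply/funext => a /=; rewrite pl1.
(* With [e1], [e2] the two Lf-restrictions read in [F]: [p1 ~ p1 l1 pi1 = g e1 pi1 ~ g g' e2 pi1 ~
   e2 pi1 = p2 l2 pi1]. *)
have p2u : homotopic R (p2 \o (l2 \o pi1)) p1.
  apply: homotopic_sym; apply: (@homotopic_trans _ _ _ (p1 \o (l1 \o pi1))).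
    by apply: homotopic_sym; exact: (homotopic_postcomp cp1 lp1).
  have -> : p1 \o (l1 \o pi1) =
      (g \o (homeo_sym i1 \o Lf_restriction L1 (i1 s0))) \o pi1.
    by apply/funext => a; rewrite /p1 /relabel_base /= end1.
  have -> : p2 \o (l2 \o pi1) =
      (homeo_sym i2 \o Lf_restriction L2 (i2 (g s0))) \o pi1.
    by apply/funext => a; rewrite /p2 /relabel_base /= end2.
  apply: (homotopic_precomp cpi1).
  apply: homotopic_trans (homotopic_postcomp cg Lg) _.
  have cLf2 : continuous (homeo_sym i2 \o Lf_restriction L2 (i2 (g s0))).
    have -> : homeo_sym i2 \o Lf_restriction L2 (i2 (g s0)) = p2 \o l2.
      by apply/funext => a; rewrite /p2 /relabel_base /= end2.
    exact: continuous_fun_comp cp2 cl2.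
  exact: (homotopic_precomp cLf2 gg').
(* Deforming [l2 \o pi1] to lie over [F] keeps its homotopy class, so [l1 \o pi2] remains a homotopy
   inverse and Dold's theorem applies. *)
have [u [cu' pu uu']] := lift_up_to_homotopy hlp2 cu p2u.
apply: (@dold_fiber_homotopy_equivalence _ _ _ _ _ _ u (l1 \o pi2)) => //; split=> //.
- apply: homotopic_trans vu; apply: homotopic_postcomp => //.
  exact: homotopic_sym.
- apply: homotopic_trans uv; apply: homotopic_precomp => //.
  exact: homotopic_sym.
Qed.
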